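(* Let $G=(V,E)$ be a finite graph that is regular of degree $d$, and let $Rot^{(G)}\in\mathbb{Z}^{|V|\times d}$ be a rotation map of $G$ in matrix form (so that $Rot^{(G)}_{v,j}$ is the vertex reached from $v$ along the edge labeled $j$ at $v$). Let $\mathcal{H}_C$ be the complex Hilbert space with orthonormal basis $\{|c_j\rangle : 1\le j\le d\}$ and let $\mathcal{H}_{\mathcal{P}}$ be the complex Hilbert space with orthonormal basis $\{|v\rangle : v\in V\}$. The shifting operator $\hat{S}$ on $\mathcal{H}_C\otimes\mathcal{H}_{\mathcal{P}}$ defined by $$\hat{S}=\sum_{j=1}^{d}\sum_{v\in V}|c_j\rangle\langle c_j|\otimes |Rot^{(G)}_{v,j}\rangle\langle v|$$ is unitary if and only if $Rot^{(G)}$ is consistent.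
   Context: Graphs are finite, undirected and simple (given by a 0/1 adjacency matrix). Write $[n]=\{1,\dots,n\}$ and identify $V$ with $[|V|]$. Rotation map: let $G=(V,E)$ be a $d$-regular graph, and suppose that at each vertex $v$ the $d$ edges leaving $v$ are labeled bijectively by $1,\dots,d$ (the labelings at the two endpoints of an edge are independent of one another, so an edge may carry different labels at its two ends). The associated rotation map is the function $Rot_G:[|V|]\times[d]\to[|V|]\times[d]$ where $Rot_G(v,i)=(w,j)$ means that the $i$-th edge leaving $v$ enters $w$, and the $j$-th edge leaving $w$ enters $v$ (this is the same edge traversed backwards, so $Rot_G$ is an involution). Matrix form: the matrix $Rot^{(G)}\in\mathbb{Z}^{|V|\times d}$ is defined by $Rot^{(G)}_{v,i}=w$ where $Rot_G(v,i)=(w,j)$. Thus row $v$ of $Rot^{(G)}$ lists the $d$ neighbors of $v$, each exactly once, in the order of the labels at $v$. Consistency: for a vertex $w$, the incoming labels at $w$ are the labels $i$ carried at $v$ by the edges leaving $v$ and entering $w$, as $v$ ranges over the $d$ neighbors of $w$; that is, one label $i$ for each pair $(v,i)$ with $Rot^{(G)}_{v,i}=w$. The graph is consistently edge labeled if each vertex has $d$ distinct incoming labels. A rotation map that encodes a consistent labeling is called consistent. Equivalently, in the matrix form, the $|V|$ entries of each column of $Rot^{(G)}$ are pairwise distinct. For vectors $|a\rangle,|b\rangle$, $|a\rangle\langle b|$ denotes the rank-one operator $|x\rangle\mapsto\langle b|x\rangle\,|a\rangle$. *)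

(* Defs.v *)
From mathcomp Require Import all_boot all_order all_algebra.
From mathcomp Require Import reals.
From mathcomp.real_closed Require Import complex.
(* [mxtens] is not imported: its notation [A ^t k] clashes with the conjugate
   transpose notation of [sesquilinear]. *)
From mathcomp.real_closed Require mxtens.

Set Implicit Arguments.
Unset Strict Implicit.
Unset Printing Implicit Defensive.

Import GRing.Theory Num.Theory.
Local Open Scope ring_scope.
Local Open Scope sesquilinear_scope.
Local Open Scope complex_scope.

(* The vertex set [n] = {1, ..., n} and the label set [d] are represented by
   the ordinals 'I_n and 'I_d, shifting all indices down by one. *)
Record sgraph (n : nat) := SGraph {
  adj : rel 'I_n;
  adj_sym : symmetric adj;
  adj_irrefl : irreflexive adj }.

Definition regular n (G : sgraph n) (d : nat) : Prop :=
  forall v, #|[set w | adj G v w]| = d.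

(* [nbr v i] is the vertex entered by the i-th edge leaving [v]; as the graph
   is simple, labelling the edges at [v] bijectively amounts to enumerating
   its neighbours bijectively. *)
Definition edge_labeling n d (G : sgraph n) (nbr : 'I_n -> 'I_d -> 'I_n) : Prop :=
  forall v, injective (nbr v) /\
            (forall w, adj G v w <-> exists i, nbr v i = w).

Definition is_rotation_map n d (G : sgraph n)
    (Rot : 'I_n * 'I_d -> 'I_n * 'I_d) : Prop :=
  exists nbr : 'I_n -> 'I_d -> 'I_n, edge_labeling G nbr /\
    forall v i w j, Rot (v, i) = (w, j) <-> nbr v i = w /\ nbr w j = v.

Definition rot_matrix n d (Rot : 'I_n * 'I_d -> 'I_n * 'I_d) : 'M['I_n]_(n, d) :=
  \matrix_(v < n, i < d) (Rot (v, i)).1.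

Definition incoming_labels n d (M : 'M['I_n]_(n, d)) (w : 'I_n) : {set 'I_d} :=
  [set p.2 | p in [set p : 'I_n * 'I_d | M p.1 p.2 == w]].

Definition consistent n d (M : 'M['I_n]_(n, d)) : Prop :=
  forall w, #|incoming_labels M w| = d.

(* C^m with its standard inner product is the Hilbert space with orthonormal
   basis ket 0, ..., ket (m - 1). *)
Definition ket (R : realType) m (i : 'I_m) : 'cV[R[i]]_m := delta_mx i 0.

Definition ketbra (R : realType) m p (a : 'cV[R[i]]_m) (b : 'cV[R[i]]_p) :
  'M[R[i]]_(m, p) := a *m b ^t*.

(* The tensor product of operators is the Kronecker product of matrices, with
   the basis vector c_j (x) v at position mxtens_index (j, v). *)
Definition shift_op (R : realType) n d (M : 'M['I_n]_(n, d)) : 'M[R[i]]_(d * n) :=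
  \sum_(j < d) \sum_(v < n)
    mxtens.tensmx (ketbra (ket R j) (ket R j)) (ketbra (ket R (M v j)) (ket R v)).

(* Main.v *)
Require Import Defs.
From mathcomp Require Import all_boot all_order all_algebra.
From mathcomp Require Import reals.
From mathcomp.real_closed Require Import complex.
From mathcomp.real_closed Require mxtens.

(** The shifting operator sends the basis vector [c_j (x) v] to
    [c_j (x) Rot v j].  An operator mapping basis vectors to basis vectors has
    Gram matrix [<f a, f b> = (f a == f b)], so it is unitary exactly when the
    underlying map [f] of the basis is injective.  Here this means that
    each column [Rot _ j] is injective; by finiteness this is surjectivity, i.e.
    every label [j] comes in at every vertex. *)

Import GRing.Theory Num.Theory.
Local Open Scope ring_scope.
Local Open Scope sesquilinear_scope.
Local Open Scope complex_scope.

Lemma unitarymx_basis_map (C : numClosedFieldType) {m : nat}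
    (f : 'I_m -> 'I_m) :
  (\matrix_(a, b) (a == f b)%:R : 'M[C]_m) \is unitarymx <-> injective f.
Proof.
set S := (X in X \is _).
(* Column [a] of [S] is the basis vector at [f a], so only the index [c = f a] survives in the inner
   product. *)
have gram a b : (S ^t* *m S) a b = (f a == f b)%:R.
  rewrite !mxE (bigD1 (f a)) //= big1 => [|c /negbTE ca]; rewrite !mxE.
    by rewrite eqxx conjC_nat mul1r addr0.
  by rewrite ca conjC_nat mul0r.
(* [unitarymxP] speaks of [S *m S ^t*], the Gram matrix is the other product; for square matrices
   either is the identity once the other is. If [f a = f b] with [a] and [b] distinct, an
   off-diagonal Gram entry would be 1. *)
split=> [/unitarymxP/mulmx1C SS1 a b fab | finj].
  move: (gram a b); rewrite SS1 fab eqxx mxE; case: eqP => //= _ /eqP.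
  by rewrite eq_sym oner_eq0.
apply/unitarymxP/mulmx1C/matrixP => a b.
by rewrite gram mxE (inj_eq finj).
Qed.

Lemma ketbra_ket (R : realType) {m p : nat} (a : 'I_m) (b : 'I_p) :
  ketbra (ket R a) (ket R b) = delta_mx a b.
Proof. by rewrite /ketbra /ket trmx_delta map_delta_mx mul_delta_mx. Qed.

Lemma tens_delta_mx (C : pzRingType) (m n p q : nat)
    (i : 'I_m) (j : 'I_n) (k : 'I_p) (l : 'I_q) :
  mxtens.tensmx (delta_mx i j : 'M[C]_(m, n)) (delta_mx k l : 'M_(p, q))
  = delta_mx (mxtens.mxtens_index (i, k)) (mxtens.mxtens_index (j, l)).
Proof.
apply/matrixP => a b.
case: (mxtens.mxtens_indexP a) => a1 a2; case: (mxtens.mxtens_indexP b) => b1 b2.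
rewrite mxtens.tensmxE !mxE !(can_eq (@mxtens.mxtens_indexK _ _)) !xpair_eqE.
by rewrite -natrM mulnb andbACA.
Qed.

Definition shift_index {n d : nat} (M : 'M['I_n]_(n, d)) (a : 'I_(d * n)) :
    'I_(d * n) :=
  let: (j, v) := mxtens.mxtens_unindex a in mxtens.mxtens_index (j, M v j).

Lemma shift_opE (R : realType) {n d : nat} (M : 'M['I_n]_(n, d)) :
  shift_op R M = \matrix_(a, b) (a == shift_index M b)%:R.
Proof.
apply/matrixP => a b; case: (mxtens.mxtens_indexP b) => k v.
have term (j : 'I_d) (u : 'I_n) :
    mxtens.tensmx (ketbra (ket R j) (ket R j)) (ketbra (ket R (M u j)) (ket R u))
      a (mxtens.mxtens_index (k, v))
    = ((a == mxtens.mxtens_index (j, M u j)) && ((k, v) == (j, u)))%:R.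
  by rewrite !ketbra_ket tens_delta_mx mxE (can_eq (@mxtens.mxtens_indexK _ _)).
(* In column [(k, v)] only the summand of the same pair is nonzero. *)
rewrite /shift_op pair_big summxE (bigD1 (k, v)) //= big1 => [|[j u] /=].
  by rewrite term eqxx andbT addr0 mxE /shift_index mxtens.mxtens_indexK.
by rewrite eq_sym term => /negbTE ->; rewrite andbF.
Qed.

(** The shift keeps the label [j], so collisions can occur only between vertices within one
    column. *)
Lemma shift_index_inj {n d : nat} (M : 'M['I_n]_(n, d)) :
  injective (shift_index M) <-> forall j, injective (M^~ j).
Proof.
split=> [inj j u v uv | inj a b].
  have /inj/(can_inj (@mxtens.mxtens_indexK _ _)) [] // :
    shift_index M (mxtens.mxtens_index (j, u))
    = shift_index M (mxtens.mxtens_index (j, v)).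
  by rewrite /shift_index !mxtens.mxtens_indexK uv.
case: (mxtens.mxtens_indexP a) => j u; case: (mxtens.mxtens_indexP b) => k v.
rewrite /shift_index !mxtens.mxtens_indexK.
by case/(can_inj (@mxtens.mxtens_indexK _ _)) => <- uv; rewrite (inj _ _ _ uv).
Qed.

Lemma consistent_col_inj {n d : nat} (M : 'M['I_n]_(n, d)) :
  consistent M <-> forall j, injective (M^~ j).
Proof.
split=> [cons j | inj w].
  have surj w : exists v, M v j == w.
    have : j \in incoming_labels M w.
      (* A set of [d] labels out of [d] contains every label. *)
      have full : incoming_labels M w = [set: 'I_d].
        by apply/eqP; rewrite eqEcard subsetT cardsT card_ord cons leqnn.
      by rewrite full inE.
    by case/imsetP=> -[v i]; rewrite inE /= => Mvw ->; exists v.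
  (* Chosen preimages form a right inverse of the column; on the finite type ['I_n] it is also a
     left inverse. *)
  have invK : cancel (fun w => xchoose (surj w)) (M^~ j).
    by move=> w; apply/eqP/(xchooseP (surj w)).
  exact: can_inj (canF_sym invK).
rewrite -[RHS]card_ord -cardsT; congr #|pred_of_set _|.
apply/setP => j; rewrite inE; apply/imsetP.
(* An injective column is a bijection of ['I_n], so [w] has a preimage along label [j]. *)
by exists (invF (inj j) w, j); rewrite ?inE //= (f_invF (inj j)).
Qed.

Theorem theorem4 (R : realType) (n d : nat) (G : sgraph n)
    (Gregular : regular G d)
    (Rot : 'I_n * 'I_d -> 'I_n * 'I_d) (RotG : is_rotation_map G Rot) :
  (shift_op R (rot_matrix Rot) \is unitarymx) <-> consistent (rot_matrix Rot).
Proof.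
rewrite shift_opE; apply: iff_trans (unitarymx_basis_map _ _) _.
exact: iff_trans (shift_index_inj _) (iff_sym (consistent_col_inj _)).
Qed.
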